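(* Let the grid $\pi$ be equidistant with stepsize $h$, and let $\Gamma,\bar\Gamma,V,\bar V$ be the matrices defined in the context. Then, for sufficiently small $h$, \[ \|\mathcal{R}\|_{\mathbb{R}^{n(mN+k)}\to L^2}=h^{1/2}\sigma_{\max}(\Gamma V)=O(h^{1/2}), \] \[ \|\mathcal{R}^{-1}\|_{L^2\to\mathbb{R}^{n(mN+k)}}=h^{-3/2}\sigma_{\min}(\bar\Gamma\bar V)^{-1}=O(h^{-3/2}), \] \[ \|\mathcal{R}\|_{\mathbb{R}^{n(mN+k)}\to H^1_{D,\pi}}=h^{1/2}\sigma_{\max}(\Gamma V)+O(h^{3/2})=O(h^{1/2}), \] and \[ h^{-3/2}\sigma_{\max}(\bar\Gamma\bar V)^{-1}\le\|\mathcal{R}^{-1}\|_{H^1_{D,\pi}\to\mathbb{R}^{n(mN+k)}}\le h^{-3/2}\sigma_{\min}(\bar\Gamma\bar V)^{-1}. \] In particular, $\|\mathcal{R}\|_{\mathbb{R}^{n(mN+k)}\to H^1_{D,\pi}}=\|\mathcal{R}\|_{\mathbb{R}^{n(mN+k)}\to L^2}+O(h^{3/2})$.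
   Context: Let $[a,b]\subset\mathbb{R}$ be a compact interval, $k<m$ positive integers, $N\ge1$ an integer, and $\pi: a=t_0<t_1<\dots<t_n=b$ a partition with stepsizes $h_j=t_j-t_{j-1}$; equidistant means $h_j=h=(b-a)/n$ for all $j$. $\mathfrak{P}_K$ is the set of real polynomials of degree at most $K$. $\tilde X_\pi$ is the space of functions $x=(x_1,\dots,x_m):[a,b]\to\mathbb{R}^m$, piecewise continuous with breakpoints only at mesh points, such that on every $[t_{j-1},t_j)$ the component $x_\kappa$ coincides with a polynomial in $\mathfrak{P}_N$ for $\kappa=1,\dots,k$ and in $\mathfrak{P}_{N-1}$ for $\kappa=k+1,\dots,m$. The polynomial piece of $x_\kappa$ on the $j$-th subinterval is denoted $x_{j\kappa}$ (functions are identified with their collections of polynomial pieces). Basis and representation map: let $\{p_0,\dots,p_{N-1}\}$ be a basis of $\mathfrak{P}_{N-1}$ (on $[0,1]$), and let $\bar p_0(\tau)=1$, $\bar p_i(\tau)=\int_0^\tau p_{i-1}(\sigma)\,d\sigma$, $i=1,\dots,N$. Put $p_{ji}(t)=p_i((t-t_{j-1})/h_j)$ and $\bar p_{ji}(t)=h_j\,\bar p_i((t-t_{j-1})/h_j)$. A coefficient vector $c=(c_1,\dots,c_n)\in\mathbb{R}^{n(mN+k)}$ has blocks $c_j=(c_{j1},\dots,c_{jm})\in\mathbb{R}^{mN+k}$ with $c_{j\kappa}=(c_{j\kappa0},\dots,c_{j\kappa N})\in\mathbb{R}^{N+1}$ for $\kappa\le k$ and $c_{j\kappa}=(c_{j\kappa0},\dots,c_{j\kappa,N-1})\in\mathbb{R}^{N}$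 for $\kappa>k$. The representation map $\mathcal{R}:\mathbb{R}^{n(mN+k)}\to\tilde X_\pi$ is the linear bijection $x=\mathcal{R}c$ given by $x_{j\kappa}=\sum_{l=0}^N c_{j\kappa l}\bar p_{jl}$ for $\kappa\le k$ and $x_{j\kappa}=\sum_{l=0}^{N-1}c_{j\kappa l}p_{jl}$ for $\kappa>k$. Norms: $\mathbb{R}^{n(mN+k)}$ carries the Euclidean norm; on $\tilde X_\pi$, $\|x\|_{L^2}^2=\sum_{j=1}^n\sum_{\kappa=1}^m\int_{t_{j-1}}^{t_j}|x_{j\kappa}(t)|^2dt$ and $\|x\|_{H^1_{D,\pi}}^2=\sum_{j=1}^n\big\{\sum_{\kappa=1}^k\int_{t_{j-1}}^{t_j}(|x_{j\kappa}(t)|^2+|x_{j\kappa}'(t)|^2)dt+\sum_{\kappa=k+1}^m\int_{t_{j-1}}^{t_j}|x_{j\kappa}(t)|^2dt\big\}$. The operator norms are taken with respect to these norms. Matrices: choose nodes $0\le\bar\sigma_1<\dots<\bar\sigma_{N+1}\le1$ and $0\le\sigma_1<\dots<\sigma_N\le1$ such that there are quadrature formulae $\int_0^1 f\approx\sum_{i=1}^{N+1}\bar\gamma_i f(\bar\sigma_i)$ and $\int_0^1 f\approx\sum_{i=1}^{N}\gamma_i f(\sigma_i)$ with positive weights that are exact for polynomials of degree up to $2N$ and $2N-2$, respectively. Let $\bar V=(\bar p_{l}(\bar\sigma_i))_{i=1..N+1,\,l=0..N}$, $V=(p_l(\sigma_i))_{i=1..N,\,l=0..N-1}$, $\bar\Gamma=\mathrm{diag}(\bar\gamma_1^{1/2},\dots,\bar\gamma_{N+1}^{1/2})$,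 $\Gamma=\mathrm{diag}(\gamma_1^{1/2},\dots,\gamma_N^{1/2})$. $\sigma_{\min}$, $\sigma_{\max}$ of a matrix denote its smallest and largest singular values. The $O(\cdot)$ statements are for $h\to0$ (i.e. $n\to\infty$) with $a,b,m,k,N$ and the basis $p_0,\dots,p_{N-1}$ fixed; the implied constants depend on $N$ and on the chosen basis. *)

(* Defs.v *)
From HB Require Import structures.
From mathcomp Require Import all_boot all_order all_algebra.
From mathcomp Require Import all_classical all_reals all_analysis.

Set Implicit Arguments.
Unset Strict Implicit.
Unset Printing Implicit Defensive.

Import Order.TTheory GRing.Theory Num.Theory numFieldNormedType.Exports.
Local Open Scope classical_set_scope.
Local Open Scope ring_scope.

(* Meant for linear maps between finite-dimensional spaces, for which the set
   below is nonempty and bounded, so that the real-valued [sup] is genuine. *)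
Definition opnorm (R : realType) (U V : Type) (nU : U -> R) (nV : V -> R)
    (f : U -> V) : R :=
  sup [set nV (f u) | u in [set u | nU u <= 1]].

Definition singular_values (R : realType) (n : nat) (A : 'M[R]_n) : set R :=
  [set Num.sqrt l | l in [set l | eigenvalue (A^T *m A) l]].

Definition sigma_max (R : realType) (n : nat) (A : 'M[R]_n) : R :=
  sup (singular_values A).

Definition sigma_min (R : realType) (n : nat) (A : 'M[R]_n) : R :=
  inf (singular_values A).

(* The antiderivative of [q] vanishing at 0; the coefficient of index 0 is
   [q`_0 / 0 = 0]. See [antiderivP] for the integral form. *)
Definition antideriv (R : realType) (N : nat) (q : {poly_N R}) :
    {poly_N.+1 R} :=
  mk_npoly N.+1 (fun i => q`_i.-1 / i%:R).

Lemma deriv_antideriv (R : realType) (N : nat) (q : {poly_N R}) :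
  (antideriv q)^`() = q.
Proof.
apply/polyP => i; rewrite coef_deriv coef_poly /= ltnS.
case: ltnP => [_|Ni]; last by rewrite mul0rn big_coef_npoly.
by rewrite -[LHS]mulr_natr mulfVK // pnatr_eq0.
Qed.

Lemma antiderivP (R : realType) (N : nat) (q : {poly_N R}) (x : R) :
  0 <= x ->
  (antideriv q).[x] = \int[lebesgue_measure]_(y in `[0, x]) q.[y].
Proof.
move=> x0.
have F0 : (antideriv q).[0] = 0.
  by rewrite horner_coef0 coef_poly /= invr0 mulr0.
move: x0; rewrite le_eqVlt => /predU1P[<-|x_gt0].
  by rewrite set_itv1 Rintegral_set1 F0.
rewrite /Rintegral (@continuous_FTC2 _ _ (horner (antideriv q)) _ _ x_gt0).
- by rewrite F0 sube0.
- exact/continuous_subspaceT/continuous_horner.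
- split=> [y _| |]; first exact: derivable_horner.
  + exact/cvg_at_right_filter/continuous_horner.
  + exact/cvg_at_left_filter/continuous_horner.
- by move=> y _; rewrite -derivE deriv_antideriv.
Qed.

Lemma size_one_npoly (R : realType) (N : nat) :
  (1 : {poly R}) \is a poly_of_size N.+1.
Proof. by rewrite qualifE /= size_poly1. Qed.

Definition pbar (R : realType) (N : nat) (p : N.-tuple {poly_N R})
    (i : 'I_N.+1) : {poly_N.+1 R} :=
  if unlift ord0 i is Some i' then antideriv (tnth p i')
  else NPoly (size_one_npoly R N).

(* Quadrature on [0, 1] with increasing nodes [s] and positive weights [w],
   exact for polynomials of degree at most [d]. *)
Definition quadrature (R : realType) (M : nat) (s w : 'I_M -> R) (d : nat) :=
  [/\ forall i, 0 <= s i <= 1,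
      forall i j : 'I_M, (i < j)%N -> s i < s j,
      forall i, 0 < w i &
      forall f : {poly R}, (size f <= d.+1)%N ->
        \int[lebesgue_measure]_(x in `[0, 1]) f.[x]
          = \sum_(i < M) w i * f.[s i]].

Definition collocation_mx (R : realType) (M : nat) (q : 'I_M -> {poly_M R})
    (s : 'I_M -> R) : 'M[R]_M :=
  \matrix_(i, l) (q l).[s i].

Definition sqrt_weight_mx (R : realType) (M : nat) (w : 'I_M -> R) : 'M[R]_M :=
  diag_mx (\row_i Num.sqrt (w i)).

(* A partition a = t_0 < ... < t_n = b is given by [a] and the tuple
   [s] = (t_1, ..., t_n) with [itv_partition a b s]. Subintervals are numbered
   from 0: the [j]-th one runs from [mesh a s j] to [mesh a s j.+1]. *)
Definition mesh (R : realType) (n : nat) (a : R) (s : n.-tuple R) (j : nat) : R :=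
  nth 0 (a :: s) j.

Definition stepsize (R : realType) (n : nat) (a : R) (s : n.-tuple R)
    (j : 'I_n) : R :=
  mesh a s j.+1 - mesh a s j.

(* A function of the ansatz space is the collection of its polynomial pieces
   (as polynomials in the global variable t): [(x j).1 i] is the piece of
   component [i + 1 <= k] (degree <= N) and [(x j).2 i] that of component
   [k + 1 + i <= m] (degree <= N - 1) on subinterval [j]. *)
Definition pwpoly (R : realType) (n m k N : nat) : vectType R :=
  {ffun 'I_n -> ({ffun 'I_k -> {poly_N.+1 R}} *
                 {ffun 'I_(m - k) -> {poly_N R}})%type}.

(* R^(n(mN+k)) in the corresponding block indexing, see [dim_coefs]. *)
Definition coefs (R : realType) (n m k N : nat) : vectType R :=
  {ffun 'I_n -> ({ffun 'I_k -> 'rV[R]_N.+1} *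
                 {ffun 'I_(m - k) -> 'rV[R]_N})%type}.

Lemma dim_coefs (R : realType) (n m k N : nat) : (k <= m)%N ->
  \dim {: coefs R n m k N} = (n * (m * N + k))%N.
Proof.
move=> km; rewrite dimvf (_ : dim _ = #|'I_n| *
  (#|'I_k| * (1 * N.+1) + #|'I_(m - k)| * (1 * N)))%N // !card_ord !mul1n.
congr (_ * _)%N.
by rewrite mulnS mulnBl -addnA subnKC ?leq_mul2r ?km ?orbT // addnC.
Qed.

Definition coefs_norm (R : realType) (n m k N : nat) (c : coefs R n m k N) : R :=
  Num.sqrt (\sum_(j < n)
    (\sum_(i < k) \sum_(l < N.+1) (c j).1 i 0 l ^+ 2 +
     \sum_(i < m - k) \sum_(l < N) (c j).2 i 0 l ^+ 2)).

Definition L2_norm (R : realType) (n m k N : nat) (a : R) (s : n.-tuple R)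
    (x : pwpoly R n m k N) : R :=
  Num.sqrt (\sum_(j < n)
    (\sum_(i < k) \int[lebesgue_measure]_(t in `[mesh a s j, mesh a s j.+1])
       (`|((x j).1 i).[t]| ^+ 2) +
     \sum_(i < m - k) \int[lebesgue_measure]_(t in `[mesh a s j, mesh a s j.+1])
       (`|((x j).2 i).[t]| ^+ 2))).

Definition H1D_norm (R : realType) (n m k N : nat) (a : R) (s : n.-tuple R)
    (x : pwpoly R n m k N) : R :=
  Num.sqrt (\sum_(j < n)
    (\sum_(i < k) \int[lebesgue_measure]_(t in `[mesh a s j, mesh a s j.+1])
       (`|((x j).1 i).[t]| ^+ 2 + `|(((x j).1 i)^`()).[t]| ^+ 2) +
     \sum_(i < m - k) \int[lebesgue_measure]_(t in `[mesh a s j, mesh a s j.+1])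
       (`|((x j).2 i).[t]| ^+ 2))).

Lemma size_rescale (R : realType) (N : nat) (u h : R) (q : {poly_N R}) :
  (q : {poly R}) \Po (h^-1 *: ('X - u%:P)) \is a poly_of_size N.
Proof.
rewrite qualifE /=; have [->|q0] := eqVneq (polyn q) 0.
  by rewrite comp_poly0 size_poly0.
have size_aff : ((size (h^-1 *: ('X - u%:P : {poly R}))).-1 <= 1)%N.
  have := size_scale_leq h^-1 ('X - u%:P : {poly R}); rewrite size_XsubC.
  by case: (size _).
apply: (leq_trans (size_comp_poly_leq _ _)); apply: leq_trans (size_npoly q).
by rewrite [leqRHS]polySpred // ltnS -[leqRHS]muln1 leq_mul2l size_aff orbT.
Qed.

(* q((t - u) / h) as a polynomial in t *)
Definition rescale (R : realType) (N : nat) (u h : R) (q : {poly_N R}) :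
    {poly_N R} :=
  NPoly (size_rescale u h q).

Definition repr_fun (R : realType) (n m k N : nat) (a : R) (s : n.-tuple R)
    (p : N.-tuple {poly_N R}) (c : coefs R n m k N) : pwpoly R n m k N :=
  [ffun j =>
    ([ffun i : 'I_k => \sum_(l < N.+1) (c j).1 i 0 l *:
        (stepsize a s j *: rescale (mesh a s j) (stepsize a s j) (pbar p l))],
     [ffun i : 'I_(m - k) => \sum_(l < N) (c j).2 i 0 l *:
        rescale (mesh a s j) (stepsize a s j) (tnth p l)])].

Lemma repr_fun_is_linear (R : realType) (n m k N : nat) (a : R)
    (s : n.-tuple R) (p : N.-tuple {poly_N R}) :
  linear (@repr_fun R n m k N a s p).
Proof.
move=> z c d; apply/ffunP => j; rewrite !ffunE; congr pair;
  apply/ffunP => i; rewrite !ffunE scaler_sumr -big_split /=;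
  by apply: eq_bigr => l _; rewrite !mxE scalerDl !scalerA ?mulrA.
Qed.

HB.instance Definition _ (R : realType) (n m k N : nat) (a : R)
    (s : n.-tuple R) (p : N.-tuple {poly_N R}) :=
  GRing.isLinear.Build R (coefs R n m k N) (pwpoly R n m k N) *:%R
    (@repr_fun R n m k N a s p) (@repr_fun_is_linear R n m k N a s p).

Definition repr_map (R : realType) (n m k N : nat) (a : R) (s : n.-tuple R)
    (p : N.-tuple {poly_N R}) : 'Hom(coefs R n m k N, pwpoly R n m k N) :=
  linfun (@repr_fun R n m k N a s p).

Lemma repr_mapE (R : realType) (n m k N : nat) (a : R) (s : n.-tuple R)
    (p : N.-tuple {poly_N R}) :
  repr_map m k a s p =1 @repr_fun R n m k N a s p.
Proof. by move=> c; rewrite lfunE. Qed.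

Lemma pbar_free (R : realType) (N : nat) (p : N.-tuple {poly_N R})
    (c : 'I_N.+1 -> R) :
  free p -> \sum_l c l *: pbar p l = 0 -> forall l, c l = 0.
Proof.
move=> /freeP p_free /(congr1 (@polyn R N.+1)).
rewrite linear_sum /= big_ord_recl /= /pbar unlift_none /= => c0.
have cS (l : 'I_N) : c (lift ord0 l) = 0.
  apply: (p_free (fun l => c (lift ord0 l))); apply: val_inj => /=.
  have := congr1 (@deriv R) c0.
  rewrite derivD derivZ derivC scaler0 add0r !linear_sum linear0 /= => dc0.
  rewrite -[RHS]dc0; apply: eq_bigr => j _.
  by rewrite liftK derivZ deriv_antideriv (tnth_nth 0).
move: c0; rewrite big1 => [|l _]; last by rewrite cS scale0r.
rewrite addr0 => /eqP; rewrite scaler_eq0 oner_eq0 orbF => /eqP c0 l.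
by case: (unliftP ord0 l) => [j ->|->] //; rewrite cS.
Qed.

Lemma rescale_sum_eq0 (R : realType) (N M : nat) (u h : R) (c : 'I_M -> R)
    (q : 'I_M -> {poly_N R}) : h != 0 ->
  \sum_l c l *: rescale u h (q l) = 0 -> \sum_l c l *: q l = 0.
Proof.
move=> h0 /(congr1 (@polyn R N)); rewrite linear_sum /= => E.
apply: val_inj => /=; rewrite linear_sum /=; apply/eqP.
rewrite -(@comp_poly2_eq0 _ _ (h^-1 *: ('X - u%:P))); last first.
  by rewrite size_scale ?invr_eq0 // size_XsubC.
rewrite linear_sum /=; apply/eqP; rewrite -[RHS]E; apply: eq_bigr => l _.
by rewrite linearZ.
Qed.

Lemma stepsize_gt0 (R : realType) (n : nat) (a b : R) (s : n.-tuple R)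
    (j : 'I_n) : itv_partition a b s -> 0 < stepsize a s j.
Proof.
case=> /(pathP 0) st _; rewrite /stepsize /mesh subr_gt0.
by apply: st; rewrite size_tuple.
Qed.

(* Hence [(repr_map m k a s p)^-1%VF] is genuinely the inverse. *)
Lemma repr_map_bij (R : realType) (n m k N : nat) (a b : R) (s : n.-tuple R)
    (p : N.-tuple {poly_N R}) :
  itv_partition a b s -> basis_of fullv p ->
  cancel (repr_map m k a s p : coefs R n m k N -> pwpoly R n m k N)
    ((repr_map m k a s p)^-1)%VF /\
  cancel ((repr_map m k a s p)^-1)%VF
    (repr_map m k a s p : coefs R n m k N -> pwpoly R n m k N).
Proof.
move=> part_s p_basis; have p_free := basis_free p_basis.
have ker0 : lker (repr_map m k a s p) == 0%VS.
  rewrite -subv0; apply/subvP => c; rewrite memv_ker memv0 repr_mapE => /eqP c0.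
  apply/eqP/ffunP => j; rewrite !ffunE.
  have h0 : stepsize a s j != 0 by rewrite gt_eqF // (stepsize_gt0 _ part_s).
  move/ffunP/(_ j) : c0; rewrite !ffunE => -[c1 c2].
  rewrite [c j]surjective_pairing; congr pair; apply/ffunP => i; rewrite !ffunE.
  - move/ffunP/(_ i) : c1; rewrite !ffunE => c1; apply/rowP => l; rewrite mxE.
    apply: (pbar_free p_free _ l).
    apply: (@rescale_sum_eq0 _ _ _ (mesh a s j) _ _ _ h0).
    apply: (scalerI h0); rewrite scaler0 scaler_sumr -[RHS]c1.
    by apply: eq_bigr => l' _; rewrite !scalerA mulrC.
  - move/ffunP/(_ i) : c2; rewrite !ffunE => c2; apply/rowP => l; rewrite mxE.
    move: (p_free) => /freeP p_free'; apply: (p_free' (fun l => (c j).2 i 0 l)).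
    rewrite -[RHS](rescale_sum_eq0 h0 c2).
    by apply: eq_bigr => l' _; rewrite (tnth_nth 0).
split; first exact: lker0_lfunK.
move=> x; rewrite limg_lfunVK //.
suff -> : limg (repr_map m k a s p) = fullv by rewrite memvf.
apply/eqP; rewrite eqEdim subvf limg_dim_eq; last by rewrite (eqP ker0) capv0.
rewrite !dimvf (_ : dim (coefs _ _ _ _ _) = #|'I_n| *
  (#|'I_k| * (1 * N.+1) + #|'I_(m - k)| * (1 * N)))%N // !mul1n.
exact: leqnn.
Qed.

(* Main.v *)
Require Import Defs.
From HB Require Import structures.
From mathcomp Require Import all_boot all_order all_algebra.
From mathcomp Require Import all_classical all_reals all_analysis.
From mathcomp Require Import ring lra.

Set Implicit Arguments.
Unset Strict Implicit.
Unset Printing Implicit Defensive.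

Import Order.TTheory GRing.Theory Num.Theory numFieldNormedType.Exports.
Local Open Scope classical_set_scope.
Local Open Scope ring_scope.

(** Scaling each subinterval to [0, 1] turns the squared L2 norm of a component
    into [h^3] times (for a differentiated component) or [h] times the energy
    [int_0^1 (sum_l c_l q_l)^2] of its coefficient row. The quadratures are exact
    on squares, so the energy is [|Gamma V c|^2] and its extrema on the unit sphere
    are squared singular values. For small [h] the [h]-terms dominate the norm of
    the representation map and the [h^3]-terms that of its inverse; the optima are
    attained at coefficient vectors with a single nonzero row. The derivative
    adds at most [h sigma_max^2 |c|^2] on the differentiated components, which
    the other components already reach, hence only an O(h^(3/2)) perturbation. *)

(** * The Euclidean inner product of row vectors *)

Definition dotrv (R : realType) (n : nat) (u v : 'rV[R]_n) : R :=
  (u *m v^T) 0 0.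

Lemma dotrvE (R : realType) (n : nat) (u v : 'rV[R]_n) :
  dotrv u v = \sum_i u 0 i * v 0 i.
Proof. by rewrite /dotrv mxE; apply: eq_bigr => i _; rewrite mxE. Qed.

Lemma dotrvC (R : realType) (n : nat) (u v : 'rV[R]_n) : dotrv u v = dotrv v u.
Proof. by rewrite !dotrvE; apply: eq_bigr => i _; rewrite mulrC. Qed.

Lemma dotrvDl (R : realType) (n : nat) (u v w : 'rV[R]_n) :
  dotrv (u + v) w = dotrv u w + dotrv v w.
Proof. by rewrite /dotrv mulmxDl mxE. Qed.

Lemma dotrvZl (R : realType) (n : nat) (a : R) (u v : 'rV[R]_n) :
  dotrv (a *: u) v = a * dotrv u v.
Proof. by rewrite /dotrv -scalemxAl mxE. Qed.

Lemma dotrvDr (R : realType) (n : nat) (u v w : 'rV[R]_n) :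
  dotrv w (u + v) = dotrv w u + dotrv w v.
Proof. by rewrite dotrvC dotrvDl !(dotrvC w). Qed.

Lemma dotrvZr (R : realType) (n : nat) (a : R) (u v : 'rV[R]_n) :
  dotrv u (a *: v) = a * dotrv u v.
Proof. by rewrite dotrvC dotrvZl dotrvC. Qed.

Lemma dotrv_sqr (R : realType) (n : nat) (u : 'rV[R]_n) :
  dotrv u u = \sum_i u 0 i ^+ 2.
Proof. by rewrite dotrvE; apply: eq_bigr => i _; rewrite expr2. Qed.

Lemma dotrv_ge0 (R : realType) (n : nat) (u : 'rV[R]_n) : 0 <= dotrv u u.
Proof. by rewrite dotrv_sqr sumr_ge0 // => i _; rewrite sqr_ge0. Qed.

Lemma dotrv_eq0 (R : realType) (n : nat) (u : 'rV[R]_n) :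
  (dotrv u u == 0) = (u == 0).
Proof.
rewrite dotrv_sqr psumr_eq0 => [|i _]; [|exact: sqr_ge0].
apply/allP/eqP => [u0|-> i _]; last by rewrite mxE expr0n /= eqxx.
apply/rowP => i; rewrite mxE; apply/eqP.
by have := u0 i (mem_index_enum i); rewrite sqrf_eq0.
Qed.

Lemma dotrv_gt0 (R : realType) (n : nat) (u : 'rV[R]_n) :
  (0 < dotrv u u) = (u != 0).
Proof. by rewrite lt_def dotrv_ge0 andbT dotrv_eq0. Qed.

Lemma dotrv_delta (R : realType) (n : nat) (i : 'I_n) :
  dotrv (delta_mx 0 i : 'rV[R]_n) (delta_mx 0 i) = 1.
Proof.
rewrite dotrv_sqr (bigD1 i) //= big1 => [|j /negPf ji].
  by rewrite mxE !eqxx expr1n addr0.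
by rewrite mxE ji andbF expr0n.
Qed.

Lemma dotrv_mulmx (R : realType) (m n : nat) (u : 'rV[R]_m) (A : 'M[R]_(m, n))
  (v : 'rV[R]_n) : dotrv (u *m A) v = dotrv u (v *m A^T).
Proof. by rewrite /dotrv trmx_mul trmxK mulmxA. Qed.

(** * Quadratic forms on the unit sphere and extreme singular values *)

Lemma continuous_qform (R : realType) (n : nat) (A : 'M[R]_n) :
  continuous (fun v : 'rV[R]_n => dotrv (v *m A) v).
Proof.
rewrite (_ : (fun v => _) = fun v : 'rV[R]_n =>
    \sum_i (\sum_j v 0 j * A j i) * v 0 i); last first.
  by apply/funext => v; rewrite dotrvE; apply: eq_bigr => i _; rewrite mxE.
have coord_mulmx i : continuous (fun v : 'rV[R]_n => \sum_j v 0 j * A j i : R).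
  apply: (@continuous_big _ _ +%R) => [|j _ v]; first exact: add_continuous.
  by apply: continuousM; [exact: coord_continuous|exact: cst_continuous].
apply: (@continuous_big _ _ +%R) => [|i _ v]; first exact: add_continuous.
by apply: continuousM; [exact: coord_mulmx|exact: coord_continuous].
Qed.

(** The sphere lies in the compact cube [-1, 1]^n, and it is closed as the preimage of 1 under the
    quadratic form of the identity matrix. *)
Lemma compact_sphere (R : realType) (n : nat) :
  compact [set v : 'rV[R]_n | dotrv v v = 1].
Proof.
have seg_compact : compact [set v : 'rV[R]_n | forall i, `[-1, 1]%classic (v ord0 i)].
  exact: (@rV_compact R n (fun=> `[-1, 1]%classic)
    (fun=> @segment_compact R (-1) 1)).
apply: subclosed_compact seg_compact _.
  rewrite (_ : mkset _ = (fun v : 'rV[R]_n => dotrv (v *m 1%:M) v) @^-1` [set 1]).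
    by move/continuous_closedP: (@continuous_qform R n 1%:M); apply; exact: closed_eq.
  by apply/seteqP; split=> v /=; rewrite mulmx1.
move=> v /= v1 i; rewrite in_itv /= -ler_norml -(@ler_pXn2r _ 2) ?nnegrE //.
rewrite real_normK ?num_real // expr1n -v1 dotrv_sqr (bigD1 i) //= lerDl.
by rewrite sumr_ge0 // => j _; rewrite sqr_ge0.
Qed.

(** The values 1 and -1 of [e] force [y <= 0], so that [e = x / (1 - y)] is well defined; it turns
    the left side into [x ^+ 2] times a positive factor. *)
Lemma linear_part_eq0 (R : realType) (x y : R) :
  (forall e, 2 * e * x + e ^+ 2 * y <= 0) -> x = 0.
Proof.
move=> H; have y_le0 : y <= 0 by have := H 1; have := H (-1); lra.
have D : 0 < 1 - y by lra.
have := H (x / (1 - y)).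
have -> : 2 * (x / (1 - y)) * x + (x / (1 - y)) ^+ 2 * y =
    x ^+ 2 * ((2 - y) / (1 - y) ^+ 2).
  by field; rewrite gt_eqF.
rewrite pmulr_lle0; last by rewrite divr_gt0 ?exprn_gt0 //; lra.
by move=> x2; apply/eqP; rewrite -sqrf_eq0 eq_le x2 sqr_ge0.
Qed.

(* A maximiser of the quadratic form on the unit sphere is an eigenvector: the
   first variation of [l |v|^2 - <vA, v>] vanishes there. *)
Lemma rayleigh_max (R : realType) (n : nat) (A : 'M[R]_n) :
  (0 < n)%N -> A^T = A ->
  exists l v, [/\ v *m A = l *: v, dotrv v v = 1 &
    forall w, dotrv (w *m A) w <= l * dotrv w w].
Proof.
move=> n_gt0 symA; pose f (v : 'rV[R]_n) := dotrv (v *m A) v.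
have [||v] := @EVT_max_rV R n f _ _ (@compact_sphere R n).
- by exists (delta_mx 0 (Ordinal n_gt0)); rewrite /= dotrv_delta.
- exact/continuous_subspaceT/continuous_qform.
rewrite inE /= => v1 v_max; exists (f v), v.
have max w : f w <= f v * dotrv w w.
  have [->|w0] := eqVneq w 0; first by rewrite /f /dotrv !mul0mx mxE mulr0.
  have w_gt0 : 0 < dotrv w w by rewrite dotrv_gt0.
  pose z := (Num.sqrt (dotrv w w))^-1.
  have z2 : z ^+ 2 = (dotrv w w)^-1 by rewrite exprVn sqr_sqrtr // dotrv_ge0.
  have := v_max (z *: w); rewrite inE /= !(dotrvZl, dotrvZr) mulrA -expr2 z2.
  rewrite mulVf ?gt_eqF // => /(_ erefl); rewrite /f -scalemxAl.
  rewrite dotrvZl dotrvZr mulrA -expr2 z2 -(ler_pM2r w_gt0) mulrAC mulVf ?mul1r //.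
  by rewrite gt_eqF.
split=> //; apply/eqP; rewrite -subr_eq0 -dotrv_eq0; apply/eqP.
(* The variation goes along the residual [w] itself, which makes |w|^2 the coefficient of [2 * e]
   when [max] is applied to [v + e *: w]. *)
move wE : (v *m A - _) => w; apply: (@linear_part_eq0 _ _ (f w - f v * dotrv w w)) => e.
have := max (v + e *: w); rewrite /f mulmxDl -scalemxAl.
rewrite !(dotrvDl, dotrvDr, dotrvZl, dotrvZr) v1 -/(f v) -/(f w).
have -> : dotrv (w *m A) v = dotrv w (v *m A) by rewrite dotrv_mulmx symA.
have ww : dotrv w w = dotrv w (v *m A) - f v * dotrv w v.
  by rewrite -{2}wE dotrvDr -scaleNr dotrvZr mulNr.
by rewrite (dotrvC (v *m A)) (dotrvC v) {2}ww; lra.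
Qed.

(** Minimising the form of [A] is maximising the form of [- A]. *)
Lemma rayleigh_min (R : realType) (n : nat) (A : 'M[R]_n) :
  (0 < n)%N -> A^T = A ->
  exists l v, [/\ v *m A = l *: v, dotrv v v = 1 &
    forall w, l * dotrv w w <= dotrv (w *m A) w].
Proof.
move=> n_gt0 symA.
have [|l [v [vl v1 lmax]]] := @rayleigh_max R n (- A) n_gt0.
  by rewrite linearN /= symA.
exists (- l), v; split=> [||w] //; first by rewrite scaleNr -vl mulmxN opprK.
have := lmax w; rewrite mulmxN -scaleN1r dotrvZl; lra.
Qed.

Lemma eigen_qform (R : realType) (n : nat) (A : 'M[R]_n) (l : R) (v : 'rV[R]_n) :
  v *m A = l *: v -> dotrv (v *m A) v = l * dotrv v v.
Proof. by move=> ->; rewrite dotrvZl. Qed.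

Lemma gram_qform_ge0 (R : realType) (n : nat) (A : 'M[R]_n) (v : 'rV[R]_n) :
  0 <= dotrv (v *m (A^T *m A)) v.
Proof. by rewrite mulmxA dotrv_mulmx dotrv_ge0. Qed.

Lemma gram_eigenvalue_ge0 (R : realType) (n : nat) (A : 'M[R]_n) (l : R) :
  eigenvalue (A^T *m A) l -> 0 <= l.
Proof.
case/eigenvalueP => v vl v0; have := gram_qform_ge0 A v.
by rewrite (eigen_qform vl) pmulr_lge0 // dotrv_gt0.
Qed.

Lemma gram_sym (R : realType) (n : nat) (A : 'M[R]_n) :
  (A^T *m A)^T = A^T *m A.
Proof. by rewrite trmx_mul trmxK. Qed.

(** The Rayleigh maximum [l] of the Gram matrix is an eigenvalue and dominates all others, so the
    supremum defining [sigma_max] is attained, at the root of [l]. The hypothesis [0 < n] keeps the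
    set of singular values nonempty. *)
Lemma sigma_max_spec (R : realType) (n : nat) (A : 'M[R]_n) : (0 < n)%N ->
  [/\ 0 <= sigma_max A,
    exists2 v, dotrv v v = 1 &
      dotrv (v *m (A^T *m A)) v = sigma_max A ^+ 2 &
    forall w, dotrv (w *m (A^T *m A)) w <= sigma_max A ^+ 2 * dotrv w w].
Proof.
move=> n_gt0; have [l [v [vl v1 lmax]]] := rayleigh_max n_gt0 (gram_sym A).
have v0 : v != 0 by rewrite -dotrv_gt0 v1.
have eigl : eigenvalue (A^T *m A) l by apply/eigenvalueP; exists v.
have l_ge0 := gram_eigenvalue_ge0 eigl.
have ub : ubound (singular_values A) (Num.sqrt l).
  move=> _ [m /eigenvalueP [w wm w0] <-]; apply: ler_wsqrtr.
  by have := lmax w; rewrite (eigen_qform wm) ler_pM2r // dotrv_gt0.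
have -> : sigma_max A = Num.sqrt l.
  apply/eqP; rewrite eq_le; apply/andP; split.
    by apply: ge_sup => //; exists (Num.sqrt l), l.
  by apply: ub_le_sup; [exists (Num.sqrt l)|exists l].
rewrite sqr_sqrtr //; split=> //; exists v => //.
by rewrite (eigen_qform vl) v1 mulr1.
Qed.

Lemma sigma_min_spec (R : realType) (n : nat) (A : 'M[R]_n) : (0 < n)%N ->
  [/\ 0 <= sigma_min A,
    exists2 v, dotrv v v = 1 &
      dotrv (v *m (A^T *m A)) v = sigma_min A ^+ 2 &
    forall w, sigma_min A ^+ 2 * dotrv w w <= dotrv (w *m (A^T *m A)) w].
Proof.
move=> n_gt0; have [l [v [vl v1 lmin]]] := rayleigh_min n_gt0 (gram_sym A).
have v0 : v != 0 by rewrite -dotrv_gt0 v1.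
have eigl : eigenvalue (A^T *m A) l by apply/eigenvalueP; exists v.
have l_ge0 := gram_eigenvalue_ge0 eigl.
have lb : lbound (singular_values A) (Num.sqrt l).
  move=> _ [m /eigenvalueP [w wm w0] <-]; apply: ler_wsqrtr.
  by have := lmin w; rewrite (eigen_qform wm) ler_pM2r // dotrv_gt0.
have -> : sigma_min A = Num.sqrt l.
  apply/eqP; rewrite eq_le; apply/andP; split.
    by apply: ge_inf; [exists (Num.sqrt l)|exists l].
  by apply: lb_le_inf => //; exists (Num.sqrt l), l.
rewrite sqr_sqrtr //; split=> //; exists v => //.
by rewrite (eigen_qform vl) v1 mulr1.
Qed.

(** * Integrals of polynomials through polynomial antiderivatives *)

Lemma Rintegral_poly (R : realType) (f F : {poly R}) (a b : R) :
  a < b -> F^`() = f ->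
  \int[lebesgue_measure]_(x in `[a, b]) f.[x] = F.[b] - F.[a].
Proof.
move=> ab Ff; rewrite /Rintegral (@continuous_FTC2 _ _ (horner F) _ _ ab) //.
- exact/continuous_subspaceT/continuous_horner.
- split=> [y _| |]; first exact: derivable_horner.
  + exact/cvg_at_right_filter/continuous_horner.
  + exact/cvg_at_left_filter/continuous_horner.
- by move=> y _; rewrite -derivE Ff.
Qed.

Lemma poly_antiderivative (R : realType) (f : {poly R}) :
  exists F : {poly R}, F^`() = f.
Proof.
have sf : f \is a poly_of_size (size f) by rewrite qualifE /=.
by exists (antideriv (NPoly sf)); rewrite deriv_antideriv.
Qed.

(** If F' = f, then h F((x - u)/h) is an antiderivative of f((x - u)/h), and its increment over
    [u, u + h] is h (F(1) - F(0)). *)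
Lemma Rintegral_rescale (R : realType) (f : {poly R}) (u h : R) : 0 < h ->
  \int[lebesgue_measure]_(x in `[u, u + h]) (f \Po (h^-1 *: ('X - u%:P))).[x] =
  h * \int[lebesgue_measure]_(x in `[0, 1]) f.[x].
Proof.
move=> h0; have [F Ff] := poly_antiderivative f.
rewrite (Rintegral_poly ltr01 Ff).
rewrite (@Rintegral_poly _ _ (h *: (F \Po (h^-1 *: ('X - u%:P))))) ?ltrDl //.
  rewrite !hornerE !horner_comp !hornerE subrr mulr0 addrAC subrr add0r.
  by rewrite mulVf ?gt_eqF // mulrBr.
rewrite derivZ deriv_comp Ff derivZ derivXsubC -scalerAr mulr1 scalerA.
by rewrite mulfV ?gt_eqF // scale1r.
Qed.

(** * Energy of a coefficient row, Gram matrices and quadrature *)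

Definition comb (R : realType) (M : nat) (q : 'I_M -> {poly R}) (c : 'rV[R]_M) :
  {poly R} := \sum_l c 0 l *: q l.

Definition energy (R : realType) (M : nat) (q : 'I_M -> {poly R})
    (c : 'rV[R]_M) : R :=
  \int[lebesgue_measure]_(x in `[0, 1]) (comb q c ^+ 2).[x].

(** Defined by exact integrals, without nodes or weights; this lets the constant of the theorem be
    fixed before the quadrature formulae are given. *)
Definition gram (R : realType) (M : nat) (q : 'I_M -> {poly R}) : 'M[R]_M :=
  \matrix_(l, l') \int[lebesgue_measure]_(x in `[0, 1]) (q l * q l').[x].

(** The condition [2 * M <= d.+2] expresses 2M - 2 <= d without truncated subtraction: it is what
    makes a quadrature of degree [d] exact on products of two polynomials of degree below M. *)
Lemma size_mul_npoly (R : realType) (M d : nat) (f g : {poly R}) :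
  (2 * M <= d.+2)%N -> (size f <= M)%N -> (size g <= M)%N ->
  (size (f * g)%R <= d.+1)%N.
Proof.
move=> Md fM gM; apply: leq_trans (size_polyMleq _ _) _.
by rewrite -subn1 leq_subLR add1n (leq_trans _ Md) // mul2n -addnn leq_add.
Qed.

Lemma size_comb (R : realType) (M : nat) (q : 'I_M -> {poly_M R}) (c : 'rV[R]_M) :
  (size (comb q c) <= M)%N.
Proof.
apply: (leq_trans (size_sum _ _ _)); apply/bigmax_leqP => l _.
by rewrite (leq_trans (size_scale_leq _ _)) // size_npoly.
Qed.

Lemma weighted_collocationE (R : realType) (M : nat) (q : 'I_M -> {poly_M R})
    (s w : 'I_M -> R) (i l : 'I_M) :
  (sqrt_weight_mx w *m collocation_mx q s) i l = Num.sqrt (w i) * (q l).[s i].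
Proof. by rewrite mul_diag_mx !mxE. Qed.

Lemma gram_quadrature (R : realType) (M d : nat) (q : 'I_M -> {poly_M R})
    (s w : 'I_M -> R) : quadrature s w d -> (2 * M <= d.+2)%N ->
  let A := sqrt_weight_mx w *m collocation_mx q s in A^T *m A = gram q.
Proof.
case=> _ _ w_gt0 quad Md A; apply/matrixP => l l'; rewrite !mxE quad; last first.
  by rewrite (size_mul_npoly Md) ?size_npoly.
apply: eq_bigr => i _; rewrite mxE !weighted_collocationE hornerM mulrACA.
by rewrite -expr2 sqr_sqrtr // ltW.
Qed.

Lemma energy_qform (R : realType) (M d : nat) (q : 'I_M -> {poly_M R})
    (s w : 'I_M -> R) (c : 'rV[R]_M) :
  quadrature s w d -> (2 * M <= d.+2)%N ->
  let A := sqrt_weight_mx w *m collocation_mx q s in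
  energy q c = dotrv (c *m (A^T *m A)) c.
Proof.
case=> _ _ w_gt0 quad Md A; rewrite /energy quad; last first.
  by rewrite expr2 (size_mul_npoly Md) ?size_comb.
rewrite mulmxA dotrv_mulmx dotrv_sqr; apply: eq_bigr => i _.
rewrite mxE horner_exp horner_sum.
under [in RHS]eq_bigr do rewrite mxE weighted_collocationE mulrCA.
rewrite -mulr_sumr exprMn sqr_sqrtr ?ltW //; congr (_ * _ ^+ 2).
by apply: eq_bigr => l _; rewrite hornerZ.
Qed.

(** A vanishing weighted sum of squares with positive weights forces zeros at M distinct nodes, too
    many for a nonzero polynomial of degree below M. *)
Lemma energy_eq0 (R : realType) (M d : nat) (q : 'I_M -> {poly_M R})
    (s w : 'I_M -> R) (c : 'rV[R]_M) :
  quadrature s w d -> (2 * M <= d.+2)%N -> energy q c = 0 -> comb q c = 0.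
Proof.
case=> _ s_incr w_gt0 quad Md; rewrite /energy quad; last first.
  by rewrite expr2 (size_mul_npoly Md) ?size_comb.
move/eqP; rewrite psumr_eq0 => [/allP q0|i _]; last first.
  by rewrite horner_exp mulr_ge0 ?sqr_ge0 // ltW.
have s_inj : injective s.
  move=> i j sij; apply: val_inj; apply/eqP; case: ltngtP => // ij.
    by have := s_incr _ _ ij; rewrite sij ltxx.
  by have := s_incr _ _ ij; rewrite sij ltxx.
apply: (@roots_geq_poly_eq0 _ _ (codom s)).
- apply/allP => _ /codomP[i ->]; apply/eqP.
  have := q0 i (mem_index_enum i); rewrite mulf_eq0 (gt_eqF (w_gt0 i)) /=.
  by rewrite horner_exp sqrf_eq0 => /eqP.
- exact/injectiveP.
- by rewrite size_codom card_ord size_comb.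
Qed.

Lemma energy_ge0 (R : realType) (M : nat) (q : 'I_M -> {poly R}) (c : 'rV[R]_M) :
  0 <= energy q c.
Proof.
by apply: Rintegral_ge0 => // x _; rewrite horner_exp sqr_ge0.
Qed.

(** * Polynomial pieces: rescaling and differentiation *)

Lemma rescale_comb (R : realType) (M M' : nat) (u h : R) (q : 'I_M -> {poly_M' R})
    (c : 'rV[R]_M) :
  (\sum_l c 0 l *: rescale u h (q l) : {poly_M' R}) =
  comb q c \Po (h^-1 *: ('X - u%:P)) :> {poly R}.
Proof.
by rewrite /comb !linear_sum /=; apply: eq_bigr => l _; rewrite linearZ.
Qed.

(** Index 0 carries the constant function of [pbar]; the entries kept here are the coefficients of
    the derivative in the basis [p]. *)
Definition tail_row (R : realType) (N : nat) (c : 'rV[R]_N.+1) : 'rV[R]_N :=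
  \row_l c 0 (lift ord0 l).

Lemma deriv_comb_pbar (R : realType) (N : nat) (p : N.-tuple {poly_N R})
    (c : 'rV[R]_N.+1) :
  (comb (pbar p) c)^`() = comb (tnth p) (tail_row c).
Proof.
rewrite /comb big_ord_recl derivD derivZ /pbar unlift_none /= derivC scaler0.
rewrite add0r linear_sum /=; apply: eq_bigr => l _.
by rewrite derivZ liftK deriv_antideriv mxE.
Qed.

Lemma Rintegral_polyZ (R : realType) (f : {poly R}) (z : R) :
  \int[lebesgue_measure]_(x in `[0, 1]) (z *: f).[x] =
  z * \int[lebesgue_measure]_(x in `[0, 1]) f.[x].
Proof.
have [F Ff] := poly_antiderivative f.
rewrite (Rintegral_poly ltr01 Ff) (@Rintegral_poly _ _ (z *: F)) //.
  by rewrite !hornerZ mulrBr.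
by rewrite derivZ Ff.
Qed.

(** The factor [z] is [h] for a differentiated component and 1 for the other components and for
    derivatives. *)
Lemma Rintegral_sqr_rescale (R : realType) (f : {poly R}) (u h z : R) : 0 < h ->
  \int[lebesgue_measure]_(x in `[u, u + h])
     (`|(z *: (f \Po (h^-1 *: ('X - u%:P)))).[x]| ^+ 2) =
  z ^+ 2 * h * \int[lebesgue_measure]_(x in `[0, 1]) (f ^+ 2).[x].
Proof.
move=> h0; rewrite -mulrA -mulr_algl.
have -> : z ^+ 2 * (h * \int[lebesgue_measure]_(x in `[0, 1]) (f ^+ 2).[x]) =
    h * \int[lebesgue_measure]_(x in `[0, 1]) ((z *: f) ^+ 2).[x].
  by rewrite mulrCA exprZn Rintegral_polyZ.
rewrite -(Rintegral_rescale _ u h0); apply: eq_Rintegral => x _.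
by rewrite real_normK ?num_real // mulr_algl -linearZ /= !horner_comp horner_exp.
Qed.

(** Additivity is read off from antiderivatives, so no integrability has to be discussed. *)
Lemma RintegralD_poly (R : realType) (f g : {poly R}) (a b : R) : a < b ->
  \int[lebesgue_measure]_(x in `[a, b]) (`|f.[x]| ^+ 2 + `|g.[x]| ^+ 2) =
  \int[lebesgue_measure]_(x in `[a, b]) (`|f.[x]| ^+ 2) +
  \int[lebesgue_measure]_(x in `[a, b]) (`|g.[x]| ^+ 2).
Proof.
move=> ab.
have sqrE (q : {poly R}) x : `|q.[x]| ^+ 2 = (q ^+ 2).[x].
  by rewrite real_normK ?num_real // horner_exp.
have [F Ff] := poly_antiderivative (f ^+ 2).
have [G Gg] := poly_antiderivative (g ^+ 2).
have intsqr q : \int[lebesgue_measure]_(x in `[a, b]) (`|q.[x]| ^+ 2) =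
    \int[lebesgue_measure]_(x in `[a, b]) (q ^+ 2).[x].
  by apply: eq_Rintegral => x _; rewrite sqrE.
under eq_Rintegral do rewrite !sqrE -hornerD.
rewrite !intsqr (Rintegral_poly ab Ff) (Rintegral_poly ab Gg).
rewrite (@Rintegral_poly _ _ (F + G)) // ?derivD ?Ff ?Gg // !hornerD; ring.
Qed.

(** * Squared norms as sums of a row functional over differentiated ([sum1]) and other ([sum2])
    rows *)

Definition sum1 (R : realType) (n m k N : nat) (e : 'rV[R]_N.+1 -> R)
    (c : coefs R n m k N) : R := \sum_j \sum_i e ((c j).1 i).

Definition sum2 (R : realType) (n m k N : nat) (e : 'rV[R]_N -> R)
    (c : coefs R n m k N) : R := \sum_j \sum_i e ((c j).2 i).

Lemma coefs_normE (R : realType) (n m k N : nat) (c : coefs R n m k N) :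
  coefs_norm c =
  Num.sqrt (sum1 (fun r => dotrv r r) c + sum2 (fun r => dotrv r r) c).
Proof.
rewrite /coefs_norm /sum1 /sum2 -big_split; congr Num.sqrt.
by apply: eq_bigr => j _; congr (_ + _); apply: eq_bigr => i _; rewrite dotrv_sqr.
Qed.

Lemma mesh_succ (R : realType) (n : nat) (a h : R) (t : n.-tuple R) (j : 'I_n) :
  stepsize a t j = h -> mesh a t j.+1 = mesh a t j + h.
Proof. by move=> <-; rewrite addrC subrK. Qed.

Lemma repr_piece1 (R : realType) (n m k N : nat) (a h : R) (t : n.-tuple R)
    (p : N.-tuple {poly_N R}) (c : coefs R n m k N) (j : 'I_n) (i : 'I_k) :
  stepsize a t j = h ->
  (repr_map m k a t p c j).1 i =
  h *: (comb (pbar p) ((c j).1 i) \Po (h^-1 *: ('X - (mesh a t j)%:P)))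
  :> {poly R}.
Proof.
move=> hj; rewrite repr_mapE !ffunE hj -rescale_comb !linear_sum /=.
by apply: eq_bigr => l _; rewrite !scalerA mulrC.
Qed.

Lemma repr_piece2 (R : realType) (n m k N : nat) (a h : R) (t : n.-tuple R)
    (p : N.-tuple {poly_N R}) (c : coefs R n m k N) (j : 'I_n) (i : 'I_(m - k)) :
  stepsize a t j = h ->
  (repr_map m k a t p c j).2 i =
  comb (tnth p) ((c j).2 i) \Po (h^-1 *: ('X - (mesh a t j)%:P)) :> {poly R}.
Proof. by move=> hj; rewrite repr_mapE !ffunE hj -rescale_comb. Qed.

(** In [h ^+ 3], two factors come from squaring the [h] in front of the scaled [pbar] and one from
    the change of variables; the other components only have the latter. *)
Lemma L2_norm_repr (R : realType) (n m k N : nat) (a h : R) (t : n.-tuple R)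
    (p : N.-tuple {poly_N R}) (c : coefs R n m k N) :
  0 < h -> (forall j, stepsize a t j = h) ->
  L2_norm a t (repr_map m k a t p c) =
  Num.sqrt (h ^+ 3 * sum1 (energy (pbar p)) c + h * sum2 (energy (tnth p)) c).
Proof.
move=> h0 hj; rewrite /L2_norm /sum1 /sum2 !mulr_sumr -big_split /=.
congr Num.sqrt; apply: eq_bigr => j _; rewrite !mulr_sumr (mesh_succ (hj j)).
congr (_ + _); apply: eq_bigr => i _.
  by rewrite (repr_piece1 _ _ _ (hj j)) Rintegral_sqr_rescale // -exprSr.
rewrite (repr_piece2 _ _ _ (hj j)) -[_ \Po _]scale1r Rintegral_sqr_rescale //.
by rewrite expr1n mul1r.
Qed.

(** Differentiation produces a factor 1/h that cancels the [h] in front of the scaled [pbar], so the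
    derivative terms carry a single [h]. *)
Lemma H1D_norm_repr (R : realType) (n m k N : nat) (a h : R) (t : n.-tuple R)
    (p : N.-tuple {poly_N R}) (c : coefs R n m k N) :
  0 < h -> (forall j, stepsize a t j = h) ->
  H1D_norm a t (repr_map m k a t p c) =
  Num.sqrt (h ^+ 3 * sum1 (energy (pbar p)) c +
    h * sum1 (energy (tnth p) \o @tail_row R N) c + h * sum2 (energy (tnth p)) c).
Proof.
move=> h0 hj; rewrite /H1D_norm /sum1 /sum2 !mulr_sumr -!big_split /=.
congr Num.sqrt; apply: eq_bigr => j _; rewrite !mulr_sumr -big_split /=.
rewrite (mesh_succ (hj j)); congr (_ + _); apply: eq_bigr => i _.
  rewrite RintegralD_poly ?ltrDl // (repr_piece1 _ _ _ (hj j)).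
  rewrite Rintegral_sqr_rescale // -exprSr; congr (_ + _).
  rewrite derivZ deriv_comp derivZ derivXsubC -scalerAr mulr1 scalerA.
  by rewrite mulfV ?gt_eqF // deriv_comb_pbar Rintegral_sqr_rescale // expr1n mul1r.
rewrite (repr_piece2 _ _ _ (hj j)) -[_ \Po _]scale1r Rintegral_sqr_rescale //.
by rewrite expr1n mul1r.
Qed.

(** * Coefficient vectors with a single nonzero row, and comparison of row sums *)

Definition single1 (R : realType) (n m k N : nat) (j0 : 'I_n) (i0 : 'I_k)
    (r : 'rV[R]_N.+1) : coefs R n m k N :=
  [ffun j => ([ffun i => if (j == j0) && (i == i0) then r else 0], [ffun=> 0])].

Definition single2 (R : realType) (n m k N : nat) (j0 : 'I_n) (i0 : 'I_(m - k))
    (r : 'rV[R]_N) : coefs R n m k N :=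
  [ffun j => ([ffun=> 0], [ffun i => if (j == j0) && (i == i0) then r else 0])].

Lemma sum_if_pair (R : realType) (V : nmodType) (I J : finType) (j0 : I)
    (i0 : J) (r : V) (e : V -> R) : e 0 = 0 ->
  \sum_j \sum_i e (if (j == j0) && (i == i0) then r else 0) = e r.
Proof.
move=> e0; rewrite (bigD1 j0) //= (bigD1 i0) //= !eqxx /= big1 => [|i /negPf->].
  rewrite addr0 big1 ?addr0 // => j /negPf ->.
  by rewrite big1.
by rewrite e0.
Qed.

Lemma sum1_single1 (R : realType) (n m k N : nat) (j : 'I_n) (i : 'I_k) r
    (e : 'rV[R]_N.+1 -> R) : e 0 = 0 -> sum1 e (single1 m j i r) = e r.
Proof.
move=> e0; rewrite -[RHS](sum_if_pair j i r e0).
by apply: eq_bigr => j' _; apply: eq_bigr => i' _; rewrite !ffunE.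
Qed.

Lemma sum2_single1 (R : realType) (n m k N : nat) (j : 'I_n) (i : 'I_k)
    (r : 'rV[R]_N.+1) (e : 'rV[R]_N -> R) :
  e 0 = 0 -> sum2 e (single1 m j i r) = 0.
Proof.
by move=> e0; apply: big1 => j' _; apply: big1 => i' _; rewrite !ffunE.
Qed.

Lemma sum2_single2 (R : realType) (n m k N : nat) (j : 'I_n) (i : 'I_(m - k)) r
    (e : 'rV[R]_N -> R) : e 0 = 0 -> sum2 e (single2 j i r) = e r.
Proof.
move=> e0; rewrite -[RHS](sum_if_pair j i r e0).
by apply: eq_bigr => j' _; apply: eq_bigr => i' _; rewrite !ffunE.
Qed.

Lemma sum1_single2 (R : realType) (n m k N : nat) (j : 'I_n) (i : 'I_(m - k))
    (r : 'rV[R]_N) (e : 'rV[R]_N.+1 -> R) :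
  e 0 = 0 -> sum1 e (single2 j i r) = 0.
Proof.
by move=> e0; apply: big1 => j' _; apply: big1 => i' _; rewrite !ffunE.
Qed.

Lemma le_sum1 (R : realType) (n m k N : nat) (K : R) (e e' : 'rV[R]_N.+1 -> R)
    (c : coefs R n m k N) :
  (forall r, e r <= K * e' r) -> sum1 e c <= K * sum1 e' c.
Proof.
move=> ee'; rewrite mulr_sumr ler_sum // => j _.
by rewrite mulr_sumr ler_sum.
Qed.

Lemma le_sum2 (R : realType) (n m k N : nat) (K : R) (e e' : 'rV[R]_N -> R)
    (c : coefs R n m k N) :
  (forall r, e r <= K * e' r) -> sum2 e c <= K * sum2 e' c.
Proof.
move=> ee'; rewrite mulr_sumr ler_sum // => j _.
by rewrite mulr_sumr ler_sum.
Qed.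

Lemma sum1_ge0 (R : realType) (n m k N : nat) (e : 'rV[R]_N.+1 -> R)
    (c : coefs R n m k N) : (forall r, 0 <= e r) -> 0 <= sum1 e c.
Proof. by move=> e0; do 2![apply: sumr_ge0 => ? _]. Qed.

Lemma sum2_ge0 (R : realType) (n m k N : nat) (e : 'rV[R]_N -> R)
    (c : coefs R n m k N) : (forall r, 0 <= e r) -> 0 <= sum2 e c.
Proof. by move=> e0; do 2![apply: sumr_ge0 => ? _]. Qed.

Lemma energyZ (R : realType) (M : nat) (q : 'I_M -> {poly R}) (z : R)
    (c : 'rV[R]_M) : energy q (z *: c) = z ^+ 2 * energy q c.
Proof.
have combZ : comb q (z *: c) = z *: comb q c.
  by rewrite scaler_sumr; apply: eq_bigr => l _; rewrite mxE scalerA.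
by rewrite /energy combZ exprZn Rintegral_polyZ.
Qed.

Lemma energy0 (R : realType) (M : nat) (q : 'I_M -> {poly R}) : energy q 0 = 0.
Proof. by rewrite -[0](scale0r 0) energyZ expr0n mul0r. Qed.

(** * Operator norms as suprema, and bounds on the energy *)

Lemma opnorm_le (R : realType) (U V : Type) (nU : U -> R) (nV : V -> R)
    (f : U -> V) (u0 : U) (K : R) :
  nU u0 <= 1 -> (forall u, nU u <= 1 -> nV (f u) <= K) -> opnorm nU nV f <= K.
Proof.
move=> u01 H; apply: ge_sup; first by exists (nV (f u0)), u0.
by move=> _ [u u1 <-]; exact: H.
Qed.

(** The uniform bound [K] ensures that the real-valued [sup] really is an upper bound. *)
Lemma le_opnorm (R : realType) (U V : Type) (nU : U -> R) (nV : V -> R)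
    (f : U -> V) (u0 : U) (K : R) :
  nU u0 <= 1 -> (forall u, nU u <= 1 -> nV (f u) <= K) ->
  nV (f u0) <= opnorm nU nV f.
Proof.
move=> u01 H; apply: ub_le_sup; last by exists u0.
by exists K => _ [u u1 <-]; exact: H.
Qed.

Lemma sqrtr_le (R : realType) (x y : R) :
  0 <= y -> x <= y ^+ 2 -> Num.sqrt x <= y.
Proof. by move=> y0 xy; rewrite -(ger0_norm y0) -sqrtr_sqr ler_wsqrtr. Qed.

Lemma sqrtr_le1 (R : realType) (x : R) : Num.sqrt x <= 1 -> x <= 1.
Proof.
by case: (leP 0 x) => [x0 x1|x0 _]; [rewrite -(sqr_sqrtr x0) exprn_ile1 ?sqrtr_ge0|lra].
Qed.

(** Strict positivity of [sigma_min]: a unit row of zero energy would represent the zero polynomial,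
    which [q_free] excludes. *)
Lemma energy_bounds (R : realType) (M d : nat) (q : 'I_M -> {poly_M R})
    (s w : 'I_M -> R) :
  (0 < M)%N -> quadrature s w d -> (2 * M <= d.+2)%N ->
  (forall c, comb q c = 0 -> c = 0) ->
  let A := sqrt_weight_mx w *m collocation_mx q s in
  [/\ 0 < sigma_min A <= sigma_max A,
    exists2 v, dotrv v v = 1 & energy q v = sigma_min A ^+ 2,
    exists2 v, dotrv v v = 1 & energy q v = sigma_max A ^+ 2 &
    forall c, sigma_min A ^+ 2 * dotrv c c <= energy q c <=
      sigma_max A ^+ 2 * dotrv c c].
Proof.
move=> M0 quad Md q_free A.
have enE c : energy q c = dotrv (c *m (A^T *m A)) c by exact: energy_qform quad Md.
have [max_ge0 [v v1 vmax] le_max] := sigma_max_spec A M0.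
have [min_ge0 [u u1 umin] ge_min] := sigma_min_spec A M0.
have min_gt0 : 0 < sigma_min A.
  rewrite lt_def min_ge0 andbT; apply/eqP => min0.
  have : energy q u = 0 by rewrite enE umin min0 expr0n.
  move=> /(energy_eq0 quad Md)/q_free u0.
  by have := dotrv_eq0 u; rewrite u1 u0 eqxx oner_eq0.
split=> [|||c].
- rewrite min_gt0 -(@ler_pXn2r _ 2) ?nnegrE //.
  by have := le_max u; rewrite umin u1 mulr1.
- by exists u => //; rewrite enE.
- by exists v => //; rewrite enE.
- by rewrite enE ge_min le_max.
Qed.

Lemma opnorm_eq (R : realType) (U V : Type) (nU : U -> R) (nV : V -> R)
    (f : U -> V) (u0 : U) (K : R) :
  nU u0 <= 1 -> nV (f u0) = K -> (forall u, nU u <= 1 -> nV (f u) <= K) ->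
  opnorm nU nV f = K.
Proof.
move=> u01 fu0 H; apply/eqP; rewrite eq_le (opnorm_le u01 H) /= -fu0.
exact: le_opnorm u01 H.
Qed.

Lemma dotrv0 (R : realType) (n : nat) : dotrv (0 : 'rV[R]_n) 0 = 0.
Proof. by apply/eqP; rewrite dotrv_eq0. Qed.

Lemma coefs_norm_single1 (R : realType) (n m k N : nat) (j : 'I_n) (i : 'I_k)
    (v : 'rV[R]_N.+1) :
  coefs_norm (single1 m j i v) = Num.sqrt (dotrv v v).
Proof. by rewrite coefs_normE sum1_single1 ?sum2_single1 ?dotrv0 // addr0. Qed.

Lemma coefs_norm_single2 (R : realType) (n m k N : nat) (j : 'I_n)
    (i : 'I_(m - k)) (v : 'rV[R]_N) :
  coefs_norm (single2 j i v) = Num.sqrt (dotrv v v).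
Proof. by rewrite coefs_normE sum1_single2 ?sum2_single2 ?dotrv0 // add0r. Qed.

(** * The four operator norms on an equidistant grid *)

Lemma cube_scale_le (R : realType) (h x y d : R) :
  0 < h -> 0 <= x -> 0 <= y -> 0 <= d -> h * x <= y ->
  h ^+ 3 * (x ^+ 2 * d) <= h * (y ^+ 2 * d).
Proof.
move=> h0 x0 y0 d0 hxy; have -> : h ^+ 3 * (x ^+ 2 * d) = h * ((h * x) ^+ 2 * d).
  by ring.
rewrite ler_pM2l // ler_wpM2r // ler_pXn2r ?nnegrE //.
by rewrite mulr_ge0 // ltW.
Qed.

Lemma sum1_dotrv_ge0 (R : realType) (n m k N : nat) (c : coefs R n m k N) :
  0 <= sum1 (fun r => dotrv r r) c.
Proof. by apply: sum1_ge0 => r; exact: dotrv_ge0. Qed.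

Lemma sum2_dotrv_ge0 (R : realType) (n m k N : nat) (c : coefs R n m k N) :
  0 <= sum2 (fun r => dotrv r r) c.
Proof. by apply: sum2_ge0 => r; exact: dotrv_ge0. Qed.

(** Here [r] is the root of [h], which makes all half-integer powers natural ones. By [small], each
    h^3-term is at most the h-term with constant [M], so the supremum is reached by putting a top
    singular vector in a nondifferentiated row. *)
Lemma opnorm_repr_L2 (R : realType) (n m k N : nat) (a h r Mb M : R)
    (t : n.-tuple R) (p : N.-tuple {poly_N R}) (j : 'I_n) (i : 'I_(m - k))
    (v : 'rV[R]_N) :
  0 < r -> h = r ^+ 2 -> (forall j, stepsize a t j = h) -> 0 <= Mb -> 0 <= M ->
  (forall c, energy (pbar p) c <= Mb ^+ 2 * dotrv c c) ->
  (forall c, energy (tnth p) c <= M ^+ 2 * dotrv c c) ->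
  dotrv v v = 1 -> energy (tnth p) v = M ^+ 2 -> h * Mb <= M ->
  opnorm (@coefs_norm R n m k N) (L2_norm a t) (repr_map m k a t p) = r * M.
Proof.
move=> r0 hE hj Mb0 M0 leMb leM v1 vM small.
have h0 : 0 < h by rewrite hE exprn_gt0.
apply: (@opnorm_eq _ _ _ _ _ _ (single2 j i v)) => [||c].
- by rewrite coefs_norm_single2 v1 sqrtr1.
- rewrite (L2_norm_repr _ _ h0 hj) sum1_single2 ?sum2_single2 ?energy0 //.
  by rewrite vM mulr0 add0r hE -exprMn sqrtr_sqr ger0_norm // mulr_ge0 // ltW.
rewrite coefs_normE => /sqrtr_le1 c1.
rewrite (L2_norm_repr _ _ h0 hj); apply: sqrtr_le.
  by rewrite mulr_ge0 // ltW.
have S1 := le_sum1 c leMb; have S2 := le_sum2 c leM.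
rewrite -(@ler_pM2l _ (h ^+ 3)) ?exprn_gt0 // in S1; rewrite -(ler_pM2l h0) in S2.
have K1 := cube_scale_le h0 Mb0 M0 (sum1_dotrv_ge0 c) small.
apply: (le_trans (lerD (le_trans S1 K1) S2)).
rewrite -mulrDr -mulrDr exprMn -hE ler_pM2l // -[leRHS]mulr1.
by rewrite ler_wpM2l // sqr_ge0.
Qed.

(** Now [small] makes [h ^+ 3 * mb ^+ 2] the weaker of the two lower bounds, hence a bound for all
    rows at once. *)
Lemma coefs_norm_le (R : realType) (n m k N : nat) (a h r mb u : R)
    (t : n.-tuple R) (p : N.-tuple {poly_N R}) (c : coefs R n m k N) :
  0 < r -> h = r ^+ 2 -> (forall j, stepsize a t j = h) -> 0 < mb -> 0 <= u ->
  (forall c, mb ^+ 2 * dotrv c c <= energy (pbar p) c) ->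
  (forall c, u ^+ 2 * dotrv c c <= energy (tnth p) c) -> h * mb <= u ->
  L2_norm a t (repr_map m k a t p c) <= 1 ->
  coefs_norm c <= (r ^+ 3)^-1 * mb^-1.
Proof.
move=> r0 hE hj mb0 u0 gemb geu small.
have h0 : 0 < h by rewrite hE exprn_gt0.
rewrite (L2_norm_repr _ _ h0 hj) => /sqrtr_le1 c1; rewrite coefs_normE.
apply: sqrtr_le; first by rewrite mulr_ge0 // invr_ge0 ltW // exprn_gt0.
have r3 : 0 < r ^+ 3 * mb by rewrite mulr_gt0 // exprn_gt0.
rewrite -invfM exprVn -[leRHS]mul1r ler_pdivlMr ?exprn_gt0 //.
apply: le_trans c1; rewrite exprMn.
have -> : (r ^+ 3) ^+ 2 = h ^+ 3 by rewrite hE -!exprM.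
rewrite mulrC -mulrA mulrDr mulrDr lerD //.
  rewrite ler_pM2l ?exprn_gt0 // mulr_sumr ler_sum // => j _.
  by rewrite mulr_sumr ler_sum.
apply: (le_trans (cube_scale_le h0 (ltW mb0) u0 (sum2_dotrv_ge0 c) small)).
rewrite ler_pM2l // mulr_sumr ler_sum // => j _.
by rewrite mulr_sumr ler_sum.
Qed.

Lemma opnorm_repr_inv_L2 (R : realType) (n m k N : nat) (a h r mb u : R)
    (t : n.-tuple R) (p : N.-tuple {poly_N R}) (j : 'I_n) (i : 'I_k)
    (v : 'rV[R]_N.+1) (f : pwpoly R n m k N -> coefs R n m k N) :
  cancel (repr_map m k a t p) f -> cancel f (repr_map m k a t p) ->
  0 < r -> h = r ^+ 2 -> (forall j, stepsize a t j = h) -> 0 < mb -> 0 <= u ->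
  (forall c, mb ^+ 2 * dotrv c c <= energy (pbar p) c) ->
  (forall c, u ^+ 2 * dotrv c c <= energy (tnth p) c) ->
  dotrv v v = 1 -> energy (pbar p) v = mb ^+ 2 -> h * mb <= u ->
  opnorm (L2_norm a t) (@coefs_norm R n m k N) f = (r ^+ 3)^-1 * mb^-1.
Proof.
move=> fK Kf r0 hE hj mb0 u0 gemb geu v1 vmb small.
have h0 : 0 < h by rewrite hE exprn_gt0.
have z0 : 0 <= (r ^+ 3)^-1 * mb^-1.
  by rewrite mulr_ge0 // invr_ge0 ltW // exprn_gt0.
(* The scaling gives [x] the L2 norm 1: its square is h^3 (r^3 mb)^(-2) mb^2 = 1. *)
pose x := repr_map m k a t p (single1 m j i (((r ^+ 3)^-1 * mb^-1) *: v)).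
apply: (@opnorm_eq _ _ _ _ _ _ x) => [||y y1].
- rewrite (L2_norm_repr _ _ h0 hj) sum1_single1 ?sum2_single1 ?energy0 //.
  rewrite energyZ vmb mulr0 addr0 -[leRHS]sqrtr1 ler_wsqrtr // hE.
  rewrite le_eqVlt; apply/orP; left; apply/eqP; field.
  by rewrite !gt_eqF.
- rewrite fK coefs_norm_single1 dotrvZl dotrvZr v1 mulr1 -expr2.
  by rewrite sqrtr_sqr ger0_norm.
by apply: (coefs_norm_le r0 hE hj mb0 u0 gemb geu small); rewrite Kf.
Qed.

Lemma L2_norm_le_H1D (R : realType) (n m k N : nat) (a h : R)
    (t : n.-tuple R) (p : N.-tuple {poly_N R}) (c : coefs R n m k N) :
  0 < h -> (forall j, stepsize a t j = h) ->
  L2_norm a t (repr_map m k a t p c) <= H1D_norm a t (repr_map m k a t p c).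
Proof.
move=> h0 hj; rewrite (L2_norm_repr _ _ h0 hj) (H1D_norm_repr _ _ h0 hj).
rewrite ler_wsqrtr // lerD2r lerDl mulr_ge0 ?(ltW h0) //.
by apply: sum1_ge0 => r; exact: energy_ge0.
Qed.

Lemma tail_row0 (R : realType) (N : nat) : tail_row (0 : 'rV[R]_N.+1) = 0.
Proof. by apply/rowP => l; rewrite !mxE. Qed.

Lemma tail_rowZ_delta (R : realType) (N : nat) (z : R) :
  tail_row (z *: delta_mx 0 ord0 : 'rV[R]_N.+1) = 0.
Proof. by apply/rowP => l; rewrite !mxE /= mulr0. Qed.

Lemma dotrv_tail_le (R : realType) (N : nat) (c : 'rV[R]_N.+1) :
  dotrv (tail_row c) (tail_row c) <= dotrv c c.
Proof.
rewrite !dotrv_sqr big_ord_recl; under eq_bigr do rewrite mxE.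
by rewrite lerDr sqr_ge0.
Qed.

(* The constants, whose derivative vanishes, are the witness for the lower
   bound. *)
Lemma opnorm_repr_inv_H1D (R : realType) (n m k N : nat) (a h r mb Mb u : R)
    (t : n.-tuple R) (p : N.-tuple {poly_N R}) (j : 'I_n) (i : 'I_k)
    (f : pwpoly R n m k N -> coefs R n m k N) :
  cancel (repr_map m k a t p) f -> cancel f (repr_map m k a t p) ->
  0 < r -> h = r ^+ 2 -> (forall j, stepsize a t j = h) -> 0 < mb <= Mb ->
  0 <= u ->
  (forall c, mb ^+ 2 * dotrv c c <= energy (pbar p) c <= Mb ^+ 2 * dotrv c c) ->
  (forall c, u ^+ 2 * dotrv c c <= energy (tnth p) c) -> h * mb <= u ->
  (r ^+ 3)^-1 * Mb^-1 <= opnorm (H1D_norm a t) (@coefs_norm R n m k N) f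
    <= (r ^+ 3)^-1 * mb^-1.
Proof.
move=> fK Kf r0 hE hj /andP[mb0 mbMb] u0 bds geu small.
have h0 : 0 < h by rewrite hE exprn_gt0.
have Mb0 := lt_le_trans mb0 mbMb.
have z0 : 0 <= (r ^+ 3)^-1 * Mb^-1.
  by rewrite mulr_ge0 // invr_ge0 ltW // exprn_gt0.
have gemb c : mb ^+ 2 * dotrv c c <= energy (pbar p) c by case/andP: (bds c).
have bound y : H1D_norm a t y <= 1 -> coefs_norm (f y) <= (r ^+ 3)^-1 * mb^-1.
  move=> y1; apply: (coefs_norm_le r0 hE hj mb0 u0 gemb geu small).
  apply: (le_trans (L2_norm_le_H1D _ _ h0 hj)).
  by rewrite Kf.
(* The constant has energy at most [Mb ^+ 2] per unit of squared norm, so this scaling keeps the H1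
   norm at most 1. *)
pose w : 'rV[R]_N.+1 := ((r ^+ 3)^-1 * Mb^-1) *: delta_mx 0 ord0.
pose x := repr_map m k a t p (single1 m j i w).
have x1 : H1D_norm a t x <= 1.
  rewrite (H1D_norm_repr _ _ h0 hj) !sum1_single1 ?sum2_single1 ?energy0 //=; last first.
    by rewrite tail_row0 energy0.
  rewrite tail_rowZ_delta energy0 !mulr0 !addr0 -[leRHS]sqrtr1 ler_wsqrtr //.
  rewrite energyZ; have /andP[_] := bds (delta_mx 0 ord0).
  rewrite dotrv_delta mulr1 => leMb.
  have z20 : 0 <= h ^+ 3 * ((r ^+ 3)^-1 * Mb^-1) ^+ 2.
    by rewrite mulr_ge0 ?exprn_ge0 // ltW.
  rewrite mulrA; apply: (le_trans (ler_wpM2l z20 leMb)).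
  rewrite le_eqVlt; apply/orP; left; apply/eqP; rewrite hE; field.
  by rewrite !gt_eqF.
apply/andP; split; last exact: opnorm_le x1 bound.
have := le_opnorm x1 bound; rewrite fK coefs_norm_single1.
by rewrite dotrvZl dotrvZr dotrv_delta mulr1 -expr2 sqrtr_sqr ger0_norm.
Qed.

(** For the lower bound, a vector without differentiated rows has no derivative terms, so its H1
    norm is its L2 norm. *)
Lemma opnorm_repr_H1D (R : realType) (n m k N : nat) (a h r Mb M : R)
    (t : n.-tuple R) (p : N.-tuple {poly_N R}) (j : 'I_n) (i : 'I_(m - k))
    (v : 'rV[R]_N) :
  0 < r -> h = r ^+ 2 -> (forall j, stepsize a t j = h) -> 0 <= Mb -> 0 <= M ->
  (forall c, energy (pbar p) c <= Mb ^+ 2 * dotrv c c) ->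
  (forall c, energy (tnth p) c <= M ^+ 2 * dotrv c c) ->
  dotrv v v = 1 -> energy (tnth p) v = M ^+ 2 ->
  r * M <= opnorm (@coefs_norm R n m k N) (H1D_norm a t) (repr_map m k a t p)
    <= r * M + r ^+ 3 * Mb.
Proof.
move=> r0 hE hj Mb0 M0 leMb leM v1 vM.
have h0 : 0 < h by rewrite hE exprn_gt0.
have rM0 : 0 <= r * M by rewrite mulr_ge0 // ltW.
have r3Mb0 : 0 <= r ^+ 3 * Mb by rewrite mulr_ge0 // ltW // exprn_gt0.
have w1 : coefs_norm (single2 j i v : coefs R n m k N) <= 1.
  by rewrite coefs_norm_single2 v1 sqrtr1.
have bound c : coefs_norm c <= 1 ->
    H1D_norm a t (repr_map m k a t p c) <= r * M + r ^+ 3 * Mb.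
  rewrite coefs_normE => /sqrtr_le1 c1.
  rewrite (H1D_norm_repr _ _ h0 hj); apply: sqrtr_le; first exact: addr_ge0.
  have S1 := le_sum1 c leMb; have S2 := le_sum2 c leM.
  have leM' x : (energy (tnth p) \o @tail_row R N) x <= M ^+ 2 * dotrv x x.
    by rewrite (le_trans (leM _)) // ler_wpM2l ?sqr_ge0 // dotrv_tail_le.
  have S3 := le_sum1 c leM'.
  have D1 := sum1_dotrv_ge0 c; have D2 := sum2_dotrv_ge0 c.
  rewrite -(@ler_pM2l _ (h ^+ 3)) ?exprn_gt0 // in S1.
  rewrite -(ler_pM2l h0) in S2; rewrite -(ler_pM2l h0) in S3.
  apply: (le_trans (lerD (lerD S1 S3) S2)).
  set d1 := sum1 _ c in D1 c1 *; set d2 := sum2 _ c in D2 c1 *.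
  (* The derivative terms join the nondifferentiated ones into a multiple of [d1 + d2], the whole
     squared norm of [c]. *)
  have -> : h ^+ 3 * (Mb ^+ 2 * d1) + h * (M ^+ 2 * d1) + h * (M ^+ 2 * d2) =
      (r ^+ 3 * Mb) ^+ 2 * d1 + (r * M) ^+ 2 * (d1 + d2) by rewrite hE; ring.
  have K1 : (r ^+ 3 * Mb) ^+ 2 * d1 <= (r ^+ 3 * Mb) ^+ 2.
    by rewrite -[leRHS]mulr1 ler_wpM2l ?sqr_ge0 //; lra.
  have K2 : (r * M) ^+ 2 * (d1 + d2) <= (r * M) ^+ 2.
    by rewrite -[leRHS]mulr1 ler_wpM2l ?sqr_ge0.
  (* A sum of two squares is at most the square of the sum, the cross term being nonnegative. *)
  by apply: (le_trans (lerD K1 K2)); have := mulr_ge0 rM0 r3Mb0; lra.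
apply/andP; split; last exact: opnorm_le w1 bound.
apply: le_trans (le_opnorm w1 bound).
rewrite (H1D_norm_repr _ _ h0 hj) !sum1_single2 ?sum2_single2 ?energy0 //=; last first.
  by rewrite tail_row0 energy0.
by rewrite vM !mulr0 !add0r hE -exprMn sqrtr_sqr ger0_norm.
Qed.

(** * Half-integer powers, linear independence, and assembly of the estimates *)

Lemma powR_half (R : realType) (h : R) : 0 <= h ->
  [/\ h `^ (1 / 2) = Num.sqrt h, h `^ (3 / 2) = Num.sqrt h ^+ 3 &
    h `^ (- (3 / 2)) = (Num.sqrt h ^+ 3)^-1].
Proof.
move=> h0; have half : h `^ (1 / 2) = Num.sqrt h by rewrite div1r powR12_sqrt.
have three_half : h `^ (3 / 2) = Num.sqrt h ^+ 3.
  rewrite -half (_ : 3 / 2 = 1 / 2 * 3%:R); last by rewrite mul1r mulrC.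
  by rewrite powRrM powR_mulrn // powR_ge0.
by rewrite powRN three_half half.
Qed.

Lemma comb_basis_eq0 (R : realType) (N : nat) (p : N.-tuple {poly_N R})
    (c : 'rV[R]_N) : basis_of fullv p -> comb (tnth p) c = 0 -> c = 0.
Proof.
move=> /basis_free/freeP p_free pc0; apply/rowP => l; rewrite mxE.
apply: (p_free (fun l => c 0 l)); apply: val_inj; rewrite -[RHS]pc0 /= linear_sum.
by apply: eq_bigr => l' _; rewrite (tnth_nth 0).
Qed.

Lemma comb_pbar_eq0 (R : realType) (N : nat) (p : N.-tuple {poly_N R})
    (c : 'rV[R]_N.+1) : basis_of fullv p -> comb (pbar p) c = 0 -> c = 0.
Proof.
move=> /basis_free p_free pc0; apply/rowP => l; rewrite mxE.
apply: (pbar_free p_free) => {l}; apply: val_inj; rewrite -[RHS]pc0 /= linear_sum.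
exact: eq_bigr.
Qed.

Theorem theorem3 (R : realType) (N : nat) (N_gt0 : (0 < N)%N)
    (p : N.-tuple {poly_N R}) (p_basis : basis_of fullv p) :
  exists C : R, forall (a b : R) (k m : nat)
      (sbar wbar : 'I_N.+1 -> R) (s w : 'I_N -> R),
    a < b -> (0 < k)%N -> (k < m)%N ->
    quadrature sbar wbar (2 * N) ->
    quadrature s w (2 * N - 2) ->
    let GVbar := sqrt_weight_mx wbar *m collocation_mx (pbar p) sbar in
    let GV := sqrt_weight_mx w *m collocation_mx (tnth p) s in
    exists2 h0 : R, 0 < h0 &
    forall (n : nat) (t : n.-tuple R),
    let h := (b - a) / n%:R in
    itv_partition a b t ->
    (forall j : 'I_n, stepsize a t j = h) ->
    h < h0 ->
    let Rep : coefs R n m k N -> pwpoly R n m k N := repr_map m k a t p in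
    let Repinv : pwpoly R n m k N -> coefs R n m k N :=
      ((repr_map m k a t p)^-1)%VF in
    let norm_L2 := opnorm (@coefs_norm R n m k N) (L2_norm a t) Rep in
    let norm_inv_L2 := opnorm (L2_norm a t) (@coefs_norm R n m k N) Repinv in
    let norm_H1 := opnorm (@coefs_norm R n m k N) (H1D_norm a t) Rep in
    let norm_inv_H1 := opnorm (H1D_norm a t) (@coefs_norm R n m k N) Repinv in
    [/\ norm_L2 = h `^ (1 / 2) * sigma_max GV /\
        `|norm_L2| <= C * h `^ (1 / 2),
        norm_inv_L2 = h `^ (- (3 / 2)) * (sigma_min GVbar)^-1 /\
        `|norm_inv_L2| <= C * h `^ (- (3 / 2)),
        `|norm_H1 - h `^ (1 / 2) * sigma_max GV| <= C * h `^ (3 / 2) /\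
        `|norm_H1| <= C * h `^ (1 / 2),
        h `^ (- (3 / 2)) * (sigma_max GVbar)^-1 <= norm_inv_H1 /\
        norm_inv_H1 <= h `^ (- (3 / 2)) * (sigma_min GVbar)^-1 &
        `|norm_H1 - norm_L2| <= C * h `^ (3 / 2)].
Proof.
(* The Gram matrices, hence the singular values, do not depend on the nodes. *)
pose sv (M : nat) (G : 'M[R]_M) := [set Num.sqrt l | l in [set l | eigenvalue G l]].
(* The summands will be [M], [Mb] and [mb^-1]: the first bounds the L2 norm, the first two the H1
   norm, the second the H1 perturbation, the third the inverse. *)
exists (sup (sv _ (gram (tnth p))) + sup (sv _ (gram (pbar p))) +
  (inf (sv _ (gram (pbar p))))^-1).
move=> a b k m sbar wbar s w ab k_gt0 km quadbar quad GVbar GV.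
(* Positivity of [N] keeps the subtraction from truncating. *)
have N2 : (2 * N <= (2 * N - 2).+2)%N by rewrite -[leqRHS]addn2 subnK // leq_pmulr.
have N2bar : (2 * N.+1 <= (2 * N).+2)%N by rewrite mulnS.
have -> : sup (sv _ (gram (tnth p))) = sigma_max GV.
  by rewrite -(gram_quadrature _ quad N2).
have -> : sup (sv _ (gram (pbar p))) = sigma_max GVbar.
  by rewrite -(gram_quadrature _ quadbar N2bar).
have -> : inf (sv _ (gram (pbar p))) = sigma_min GVbar.
  by rewrite -(gram_quadrature _ quadbar N2bar).
have [minmax _ [v v1 vM] bds] :=
  energy_bounds N_gt0 quad N2 (fun c => @comb_basis_eq0 _ _ p c p_basis).
have [minmaxbar [vb vb1 vbm] _ bdsbar] :=
  energy_bounds (ltn0Sn N) quadbar N2bar (fun c => @comb_pbar_eq0 _ _ p c p_basis).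
rewrite -/GV in minmax vM bds; rewrite -/GVbar in minmaxbar vbm bdsbar.
move: (sigma_max GV) (sigma_min GV) (sigma_max GVbar) (sigma_min GVbar)
  minmax vM bds minmaxbar vbm bdsbar
  => M u Mb mb /andP[u0 uM] vM bds /andP[mb0 mbMb] vbm bdsbar.
have M0 : 0 < M := lt_le_trans u0 uM.
have Mb0 : 0 < Mb := lt_le_trans mb0 mbMb.
(* The bound 1 gives h^(3/2) <= h^(1/2); the two quotients give [h * Mb <= M] and [h * mb <= u],
   needed for the norm of the map and of its inverse. *)
exists (Num.min 1 (Num.min (M / Mb) (u / mb))).
  by rewrite !lt_min ltr01 !divr_gt0.
move=> n t h part_t hj; rewrite !lt_min => /and3P[h_lt1 h_ltM h_ltu].
(* An empty partition would force a = b. *)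
have n_gt0 : (0 < n)%N.
  case: n t h part_t {hj h_lt1 h_ltM h_ltu} => // t h [_].
  by rewrite tuple0 /= => /eqP abE; rewrite abE ltxx in ab.
have h_gt0 : 0 < h by rewrite divr_gt0 ?subr_gt0 ?ltr0n.
have hMb : h * Mb <= M by rewrite -ler_pdivlMr // ltW.
have hmb : h * mb <= u by rewrite -ler_pdivlMr // ltW.
move=> Rep Repinv norm_L2 norm_inv_L2 norm_H1 norm_inv_H1.
have [-> -> ->] := powR_half (ltW h_gt0).
pose r := Num.sqrt h; rewrite -/r.
have r0 : 0 < r by rewrite sqrtr_gt0.
have hE : h = r ^+ 2 by rewrite sqr_sqrtr // ltW.
have [RepK RepinvK] := repr_map_bij m k part_t p_basis.
pose j0 := Ordinal n_gt0; pose i1 := Ordinal k_gt0.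
have km0 : (0 < m - k)%N by rewrite subn_gt0.
pose i2 := Ordinal km0.
have leM c : energy (tnth p) c <= M ^+ 2 * dotrv c c by case/andP: (bds c).
have geu c : u ^+ 2 * dotrv c c <= energy (tnth p) c by case/andP: (bds c).
have leMb c : energy (pbar p) c <= Mb ^+ 2 * dotrv c c by case/andP: (bdsbar c).
have gemb c : mb ^+ 2 * dotrv c c <= energy (pbar p) c by case/andP: (bdsbar c).
have mbbds : 0 < mb <= Mb by rewrite mb0.
have L2E : norm_L2 = r * M :=
  opnorm_repr_L2 j0 i2 r0 hE hj (ltW Mb0) (ltW M0) leMb leM v1 vM hMb.
have invL2E : norm_inv_L2 = (r ^+ 3)^-1 * mb^-1 :=
  opnorm_repr_inv_L2 j0 i1 RepK RepinvK r0 hE hj mb0 (ltW u0) gemb geu vb1 vbm hmb.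
have /andP[H1_ge H1_le] : r * M <= norm_H1 <= r * M + r ^+ 3 * Mb :=
  opnorm_repr_H1D j0 i2 r0 hE hj (ltW Mb0) (ltW M0) leMb leM v1 vM.
have /andP[invH1_ge invH1_le] :
    (r ^+ 3)^-1 * Mb^-1 <= norm_inv_H1 <= (r ^+ 3)^-1 * mb^-1 :=
  opnorm_repr_inv_H1D j0 i1 RepK RepinvK r0 hE hj mbbds (ltW u0) bdsbar geu hmb.
have r3_gt0 : 0 < r ^+ 3 by rewrite exprn_gt0.
have mbV0 : 0 < mb^-1 by rewrite invr_gt0.
have rM0 : 0 < r * M by rewrite mulr_gt0.
(* Since [norm_L2] equals [r * M], this also settles the final comparison of the two norms. *)
have dist_H1 : `|norm_H1 - r * M| <= (M + Mb + mb^-1) * r ^+ 3.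
  rewrite ger0_norm ?subr_ge0 // lerBlDl (le_trans H1_le) // lerD2l mulrC.
  by rewrite ler_wpM2r ?(ltW r3_gt0) //; lra.
split=> //; last by rewrite L2E.
- split=> //; rewrite L2E gtr0_norm // mulrC ler_wpM2r ?(ltW r0) //; lra.
- split=> //; rewrite invL2E gtr0_norm ?mulr_gt0 ?invr_gt0 // mulrC.
  by rewrite ler_wpM2r ?invr_ge0 ?(ltW r3_gt0) //; lra.
- split=> //; rewrite ger0_norm ?(le_trans _ H1_ge) ?(ltW rM0) //.
  apply: (le_trans H1_le).
  have r3r : r ^+ 3 * Mb <= r * Mb.
    by rewrite ler_wpM2r ?(ltW Mb0) // exprS -hE ger_pMr // ltW.
  apply: (le_trans (lerD (lexx _) r3r)).
  by rewrite -mulrDr mulrC ler_wpM2r ?(ltW r0) //; lra.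
Qed.
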